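(* Let $p,q$ be integers with $q>p>1$. Consider the propagation problem described by the $1\times 1$ matrix $M=(2^{p})$ with $\Delta=2^{q}$; that is, the labels are red (the initial label) and white (the wildcard label), the root must be red, and every red vertex must have at least $2^{p}$ red children, on the infinite $2^{q}$-regular rooted tree. Then its mending volume up to distance $\lfloor\log_\Delta n\rfloor$ is $\Theta(n^{p/q})$ as $n\to\infty$.
   Context: The infinite $\Delta$-regular rooted tree is the infinite tree with one distinguished root in which every vertex has a (unique) directed path to the root and exactly $\Delta$ children. Propagation problem: a finite label set $\Sigma$ with two special labels, the initial label $l_0$ and the wildcard label $l_-$ ; $\Sigma'=\Sigma\setminus\{l_-\}$; a function $\mu:\Sigma'\times\Sigma'\to\mathbb N$ and an integer $\Delta\ge\max_{l\in\Sigma'}\sum_{l'\in\Sigma'}\mu(l,l')$. On the infinite $\Delta$-regular rooted tree a labeling $\lambda$ is accepted at vertex $v$ iff (a) $\lambda(v)=l_0$ if $v$ is the root, and (b) if $\lambda(v)=l\neq l_-$ then for every $l'\in\Sigma'$ at least $\mu(l,l')$ children of $v$ are labeled $l'$. The problem is described by the matrix $M[l,l']=\mu(l,l')$ indexed by $\Sigma'$. A partial solution is a labeling with values in $\Sigma\sqcup\{\bot\}$ such that every vertex having no $\bot$ in its radius-1 neighborhood (itself, its parent, its children) is accepted. A hole is a vertex labeled $\bot$. A mend of a partial solution $\lambda$ at a hole $v$ is a partial solution $\lambda'$ with $\lambda'(v)\neq\bot$ and $\lambda'(u)\ne\bot$ whenever $\lambda(u)\neq\bot$. The mending volume up to distance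 $d_{\max}$ is $\max_{\lambda,v}\min_{\lambda'}|\{u:\lambda(u)\ne\lambda'(u),\ \mathrm{dist}(u,v)\le d_{\max}\}|$, over partial solutions $\lambda$, holes $v$ of $\lambda$, and mends $\lambda'$ of $\lambda$ at $v$. *)

(* Defs.v *)
From HB Require Import structures.
From mathcomp Require Import all_boot all_order all_algebra.
From mathcomp Require Import finmap.
From mathcomp Require Import all_classical all_reals all_analysis.

Set Implicit Arguments.
Unset Strict Implicit.
Unset Printing Implicit Defensive.

Import Order.TTheory.

Local Open Scope classical_set_scope.
Local Open Scope nat_scope.

(* A vertex is the list of child indices met on its directed path to the root:
   the root is [::] and the children of v are the i :: v. *)
Definition vertex (D : nat) : Type := seq 'I_D.

Definition root D : vertex D := [::].

Definition child D (v : vertex D) (i : 'I_D) : vertex D := i :: v.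

Definition is_child D (u v : vertex D) : bool := [exists i, u == child v i].

Definition adj D : rel (vertex D) :=
  fun u v => is_child u v || is_child v u.

Definition dist D (u v : vertex D) : nat :=
  infimum 0 [set size s | s in [set s | path (@adj D) u s /\ last u s = v]].

(* [core] is the set of labels other than the wildcard; the initial label is
   assumed to be different from the wildcard. *)
Record propagation := Propagation {
  core : finType;
  init : core;
  mu : core -> core -> nat;
  degree : nat;
  mu_degree : forall l, \sum_l' mu l l' <= degree }.

Section PropagationProblem.
Variable P : propagation.

(* None is the wildcard label. *)
Definition label : Type := option (core P).

(* None is the symbol of a hole; Some None is the wildcard label. *)
Definition labeling : Type := vertex (degree P) -> option label.

Implicit Types (lam : labeling) (v : vertex (degree P)).

Definition accepted lam v : Prop :=
  (v = root _ -> lam v = Some (Some (init P))) /\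
  forall l, lam v = Some (Some l) ->
    forall l', mu l l' <= #|[pred i | lam (child v i) == Some (Some l')]|.

Definition hole lam v : Prop := lam v = None.

Definition partial_solution lam : Prop :=
  forall v, (forall u, u = v \/ adj v u -> ~ hole lam u) -> accepted lam v.

Definition mend lam v (lam' : labeling) : Prop :=
  [/\ partial_solution lam', ~ hole lam' v &
      forall u, ~ hole lam u -> ~ hole lam' u].

Definition changed lam lam' v (d : nat) : set (vertex (degree P)) :=
  [set u | lam u <> lam' u /\ dist u v <= d].

Definition mending_cost lam v (d : nat) : nat :=
  infimum 0 [set #|` fset_set (changed lam lam' v d)|%fset
            | lam' in [set lam' | mend lam v lam']].

Definition mending_volume (d : nat) : nat :=
  supremum 0 [set m | exists lam v, [/\ partial_solution lam, hole lam v &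
                                       m = mending_cost lam v d]].

End PropagationProblem.

(* The problem described by a matrix; the label of index 0 is the initial one. *)
Definition propagation_of_mx k (M : 'M[nat]_k.+1) (D : nat)
    (hM : forall l, \sum_l' M l l' <= D) : propagation :=
  @Propagation 'I_k.+1 ord0 (fun l l' => M l l') D hM.

Lemma const_mx1_degree p q : p < q ->
  forall l, \sum_l' (const_mx (2 ^ p) : 'M[nat]_1) l l' <= 2 ^ q.
Proof.
by move=> pq l; rewrite big_ord1 mxE leq_exp2l // ltnW.
Qed.

(* Some ord0 is red and None is white. *)
Definition red_white p q (hpq : p < q) : propagation :=
  propagation_of_mx (const_mx1_degree hpq).

(* The infima and suprema above are attained minima and maxima ([distP],
   [mending_costP], [mending_volumeP]), every hole has a mend, and the sets
   whose cardinals are taken are finite. *)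

Lemma nat_infimum_min (A : set nat) : A !=set0 ->
  A (infimum 0 A) /\ forall x, A x -> infimum 0 A <= x.
Proof.
move=> A0.
have [m Am mA] : exists2 m, A m & forall x, A x -> m <= x.
  have exA : exists n, `[< A n >] by case: A0 => x Ax; exists x; apply/asboolP.
  case: (ex_minnP exA) => m /asboolP Am mA.
  by exists m => // x Ax; apply: mA; apply/asboolP.
have mi : infimums A m.
  by split => [x Ax|y yA]; rewrite ?leEnat; [exact: mA | exact: yA].
rewrite /infimum; case: ifPn => [/eqP AE|_]; first by rewrite AE in Am.
case: xgetP => [y _ yA|/(_ m) //].
by rewrite (is_subset1_infimums yA mi).
Qed.

Lemma nat_supremum_max (A : set nat) : A !=set0 -> ubound A !=set0 ->
  A (supremum 0 A) /\ forall x, A x -> x <= supremum 0 A.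
Proof.
move=> A0 [b bA].
have [m Am mA] : exists2 m, A m & forall x, A x -> x <= m.
  have exA : exists n, `[< A n >] by case: A0 => x Ax; exists x; apply/asboolP.
  have ubA n : `[< A n >] -> n <= b by move/asboolP/bA.
  case: (ex_maxnP exA ubA) => m /asboolP Am mA.
  by exists m => // x Ax; apply: mA; apply/asboolP.
have mi : supremums A m.
  by split => [x Ax|y yA]; rewrite ?leEnat; [exact: mA | exact: yA].
rewrite /supremum; case: ifPn => [/eqP AE|_]; first by rewrite AE in Am.
case: xgetP => [y _ yA|/(_ m) //].
by rewrite (is_subset1_supremums yA mi).
Qed.

Section Tree.
Variable D : nat.
Implicit Types u v w : vertex D.

Lemma adj_sym u v : adj u v = adj v u.
Proof. exact: orbC. Qed.

Lemma adj_child v i : adj v (child v i).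
Proof. by apply/orP; right; apply/existsP; exists i. Qed.

Lemma adj_size u v : adj u v -> size u <= (size v).+1.
Proof.
by case/orP => /existsP[i /eqP ->] //=; rewrite ltnW // ltnS leqnSn.
Qed.

Lemma walk_exists u v : exists s, path (@adj D) u s /\ last u s = v.
Proof.
have toroot w : exists s, path (@adj D) w s /\ last w s = root D.
  elim: w => [|i w [s [ps ls]]]; first by exists [::].
  exists (w :: s) => /=; split => //.
  by rewrite ps andbT adj_sym adj_child.
have fromroot w : exists s, path (@adj D) (root D) s /\ last (root D) s = w.
  elim: w => [|i w [s [ps ls]]]; first by exists [::].
  exists (rcons s (child w i)); rewrite last_rcons; split => //.
  by rewrite rcons_path ps ls adj_child.
have [s [ps ls]] := toroot u; have [t [pt lt]] := fromroot v.
by exists (s ++ t); rewrite cat_path last_cat ps ls.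
Qed.

Lemma distP u v :
  (exists s, [/\ path (@adj D) u s, last u s = v & size s = dist u v]) /\
  forall s, path (@adj D) u s -> last u s = v -> dist u v <= size s.
Proof.
have [|[s [ps ls] ss] mins] := @nat_infimum_min
  [set size s | s in [set s | path (@adj D) u s /\ last u s = v]].
  by have [s hs] := walk_exists u v; exists (size s), s.
split; first by exists s.
by move=> t pt lt; apply: mins; exists t.
Qed.

Lemma size_le_dist u v : size u <= size v + dist u v.
Proof.
have [[s [ps <- <-]] _] := distP u v.
elim: s u ps => [|w s IH] u /=; first by rewrite addn0.
case/andP => uw /IH ws; apply: leq_trans (adj_size uw) _.
by rewrite addnS ltnS.
Qed.

Lemma finite_size_le n : finite_set [set u : vertex D | size u <= n].
Proof.
elim: n => [|n IH].
  apply: (sub_finite_set _ (finite_set1 (root D))) => u /=.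
  by rewrite leqn0 => /nilP ->.
have F := finite_image2 (@cons 'I_D) (@finite_finset _ setT) IH.
have FU : finite_set ([set root D] `|` [set x :: y | x in setT & y in
    [set u : vertex D | size u <= n]]) by rewrite finite_setU.
apply: (sub_finite_set _ FU).
move=> [|i u] /=; first by left.
by rewrite ltnS => un; right; exists i => //; exists u.
Qed.

Lemma finite_ball v d : finite_set [set u | dist u v <= d].
Proof.
apply: (sub_finite_set _ (finite_size_le (size v + d))) => u /= ud.
by apply: leq_trans (size_le_dist u v) _; rewrite leq_add2l.
Qed.

(* The number of walks of length d bounds the size of the ball uniformly in v. *)
Lemma card_ball v d :
  #|` fset_set [set u | dist u v <= d]|%fset <=
  #|{: d.-tuple (option (option 'I_D))}|.
Proof.
pose step (o : option (option 'I_D)) u : vertex D :=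
  if o is Some o' then (if o' is Some i then i :: u else behead u) else u.
have stepP u w : adj u w -> exists o, u = step o w.
  by case/orP => /existsP[i /eqP ->]; [exists (Some (Some i))|exists (Some None)].
have walkP s u : path (@adj D) u s -> size s <= d ->
    exists t : d.-tuple (option (option 'I_D)), u = foldr step (last u s) t.
  move=> ps sd; suff [t st ut] : exists2 t, size t = size s &
      u = foldr step (last u s) t.
    have szt : size (nseq (d - size s) None ++ t) == d.
      by rewrite size_cat size_nseq st subnK.
    exists (Tuple szt) => /=; rewrite foldr_cat {1}ut.
    by elim: (d - size s) => //= n IHn; exact: IHn.
  elim: s u ps {sd} => [|w s IH] u /=; first by exists [::].
  case/andP => /stepP[x ux] /IH[t st wt].
  by exists (x :: t); rewrite /= ?st // -wt.
rewrite cardE -(size_map (fun t : d.-tuple _ => foldr step v t)).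
set r := map _ _.
have sub : (fset_set [set u | dist u v <= d] `<=` [fset x in r])%fset.
  apply/fsubsetP => u; rewrite in_fset_set; last exact: finite_ball.
  rewrite inE /= => ud.
  have [[s [ps ls ss]] _] := distP u v.
  rewrite -ss in ud; have [t ut] := walkP s u ps ud.
  by rewrite inE /= ut ls; apply/mapP; exists t; rewrite ?mem_enum.
apply: leq_trans (fsubset_leq_card sub) _.
by rewrite card_fseq size_undup.
Qed.

End Tree.

Section Attained.
Variable P : propagation.
Implicit Types (lam : labeling P) (v : vertex (degree P)).

Lemma finite_changed lam lam' v d : finite_set (changed lam lam' v d).
Proof. by apply: (sub_finite_set _ (finite_ball v d)) => u []. Qed.

Lemma complete_solution :
  exists lam, partial_solution lam /\ forall v, ~ hole lam v.
Proof.
pose kids (l : label P) : seq (label P) := if l is Some c then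
  flatten [seq nseq (mu c c') (Some c') | c' <- enum (core P)] else [::].
pose sol := fix sol (v : vertex (degree P)) : label P :=
  if v is i :: u then nth None (kids (sol u)) i else Some (init P).
exists (fun v => Some (sol v)); split=> // v _; split=> [->//|l [lv] l'].
have szk : size (kids (Some l)) <= degree P.
  rewrite size_flatten /shape -map_comp sumnE big_map big_enum /=.
  under eq_bigr do rewrite size_nseq.
  exact: mu_degree.
have cntk : count_mem (Some l') (kids (Some l)) = mu l l'.
  rewrite count_flatten -map_comp sumnE big_map big_enum /=.
  rewrite (bigD1 l') //= count_nseq /= eqxx mul1n big1 ?addn0 // => c cl.
  rewrite count_nseq /=; suff -> : (Some c == Some l') = false by [].
  by apply/negbTE; apply: contra cl => /eqP[->].
rewrite -cntk.
pose T := [pred i : 'I_(size (kids (Some l))) |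
  nth None (kids (Some l)) i == Some l'].
have <- : #|T| = count_mem (Some l') (kids (Some l)).
  by rewrite -sum1_count (big_nth None) big_mkord -sum1_card.
have inj : injective (widen_ord szk) by move=> i j /(congr1 val) /= /val_inj.
rewrite -(fintype.card_image inj T).
apply: subset_leq_card; apply/fintype.subsetP => _ /fintype.imageP[i iT ->].
by move: lv iT; rewrite !inE /= => ->.
Qed.

Lemma mend_exists lam v : exists lam', mend lam v lam'.
Proof. by have [s [ps hs]] := complete_solution; exists s; split. Qed.

Lemma mending_costP lam v d :
  (exists2 lam', mend lam v lam' &
     mending_cost lam v d = #|` fset_set (changed lam lam' v d)|%fset) /\
  forall lam', mend lam v lam' ->
     mending_cost lam v d <= #|` fset_set (changed lam lam' v d)|%fset.
Proof.
have [|[lam' mlam' E] mins] := @nat_infimum_min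
  [set #|` fset_set (changed lam lam' v d)|%fset
            | lam' in [set lam' | mend lam v lam']].
  by have [s ms] := mend_exists lam v; exists
    #|` fset_set (changed lam s v d)|%fset, s.
by split; [exists lam' | move=> t mt; apply: mins; exists t].
Qed.

Lemma mending_volumeP d :
  (exists lam v, [/\ partial_solution lam, hole lam v &
                     mending_volume P d = mending_cost lam v d]) /\
  forall lam v, partial_solution lam -> hole lam v ->
    mending_cost lam v d <= mending_volume P d.
Proof.
have [||[lam [v [pl hv E]]] mx] := @nat_supremum_max
  [set m | exists lam v, [/\ partial_solution lam, hole lam v &
                             m = mending_cost lam v d]].
- exists (mending_cost (fun=> None) (root (degree P)) d), (fun=> None), (root _).
  split=> // v nh; have [] := nh v; by [left|].
- exists #|{: d.-tuple (option (option 'I_(degree P)))}| => _ [lam [v [_ _ ->]]].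
  have [[lam' _ ->] _] := mending_costP lam v d.
  apply: leq_trans (card_ball v d); apply: fsubset_leq_card.
  rewrite -fset_set_sub; [|exact: finite_changed|exact: finite_ball].
  by move=> u [].
by split; [exists lam, v | move=> s u ps hs; apply: mx; exists s, u].
Qed.

End Attained.

(* Main.v *)
(** Write k = 2^p, D = 2^q and d = floor (log_D n), so that k^d is n^(p/q) up to
    a factor k, and it suffices to compare the volume with k^d.  For the lower
    bound, let the root be the only hole of an otherwise white tree: a mend is a
    full solution, hence has at least k^d red vertices at depth d.  For the upper
    bound, paint red a complete k-ary tree through the hole v, and paint white
    the other red children of its vertices.  The tree starts at the parent of v,
    because filling v may expose that parent to the acceptance condition, unless
    the parent is itself a hole (or v is the root): then it stays a hole and the
    tree starts at v.  Only O(k^d) vertices change within distance d of v. *)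

Require Import Defs.
From mathcomp Require Import all_boot all_order all_algebra.
From mathcomp Require Import finmap.
From mathcomp Require Import all_classical all_reals all_analysis.
From mathcomp Require Import zify ring.
Import Order.TTheory GRing.Theory Num.Theory numFieldNormedType.Exports.

Local Notation root := Defs.root.
Local Open Scope nat_scope.

(** [i0] is prescribed because a tree started at the parent of a hole must pass through that
    hole. *)
Lemma uniq_seq_through D k (i0 : 'I_D) : 0 < k <= D ->
  exists K : seq 'I_D, [/\ uniq K, size K = k & i0 \in K].
Proof.
case: k => // k /= kD; exists (take k.+1 (i0 :: rem i0 (enum 'I_D))).
split; last by rewrite inE eqxx.
  by rewrite take_uniq //= mem_rem_uniq ?rem_uniq ?enum_uniq // inE eqxx.
rewrite size_takel //= size_rem ?mem_enum // size_enum_ord prednK //.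
exact: leq_trans kD.
Qed.

(** * Counting words over a set of directions *)

Section Words.
Variables (T : eqType) (K : seq T).

Fixpoint words (n : nat) : seq (seq T) :=
  [::] :: if n is m.+1 then [seq i :: s | i <- K, s <- words m] else [::].

Lemma mem_words n s : all (mem K) s -> size s <= n -> s \in words n.
Proof.
elim: n s => [|n IH] [|i s] //= /andP[iK sK] sn.
by rewrite inE; apply/allpairsP; exists (i, s); rewrite iK IH.
Qed.

(** Strictness closes the induction: [1 + |K| * x < |K| * (x + 1)] as soon as [|K| > 1]. *)
Lemma size_words n : 1 < size K -> size (words n) < size K ^ n.+1.
Proof.
move=> K1; elim: n => [|n IH] /=; first by rewrite expn1.
rewrite size_allpairs (expnS _ n.+1).
apply: leq_trans (_ : size K * (size (words n)).+1 <= _).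
  by rewrite mulnS; move: (size K * _) => x; lia.
by rewrite leq_mul2l IH orbT.
Qed.

End Words.

Lemma dist_root_le D (u : vertex D) : dist u (root D) <= size u.
Proof.
suff [s [ps ls <-]] : exists s, [/\ path (@adj D) u s, last u s = root D &
    size s = size u] by have [_] := distP u (root D); apply.
elim: u => [|i w [s [ps ls ss]]]; first by exists [::].
by exists (w :: s); rewrite /= ss adj_sym (adj_child w i) ps.
Qed.

Lemma uniq_leq_card_changed (P : propagation) (lam lam' : labeling P) v d
    (s : seq (vertex (degree P))) :
  uniq s -> (forall u, u \in s -> changed lam lam' v d u) ->
  size s <= #|` fset_set (changed lam lam' v d)|%fset.
Proof.
move=> us sc; rewrite -(undup_id us) -card_fseq; apply: fsubset_leq_card.
apply/fsubsetP => u; rewrite inE /= => /sc cu.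
by rewrite in_fset_set ?inE //; exact: finite_changed.
Qed.

Lemma card_changed_leq (P : propagation) (lam lam' : labeling P) v d
    (s : seq (vertex (degree P))) :
  (forall u, changed lam lam' v d u -> u \in s) ->
  #|` fset_set (changed lam lam' v d)|%fset <= size s.
Proof.
move=> cs; apply: leq_trans (size_undup s).
rewrite -card_fseq; apply: fsubset_leq_card.
apply/fsubsetP => u; rewrite in_fset_set; last exact: finite_changed.
by rewrite !inE /= => /cs.
Qed.

(** * The red-white problem and the lower bound *)

Section RedWhite.
Variables (p q : nat) (hpq : p < q).
Let P := red_white hpq.
Let D := 2 ^ q.
Let k := 2 ^ p.

Definition red : option (label P) := Some (Some ord0).
Definition white : option (label P) := Some None.

Lemma acceptedP (lam : labeling P) v : accepted lam v <->
  (v = root _ -> lam v = red) /\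
  (lam v = red -> k <= #|[pred i : 'I_D | lam (i :: v) == red]|).
Proof.
split=> -[rt acc]; split=> //; first by move=> /acc /(_ ord0); rewrite /mu /= mxE.
by move=> l; rewrite /mu /= (ord1 l) => /acc h l'; rewrite (ord1 l') mxE.
Qed.

(** By induction on the depth: the root is red, and the red children of distinct red vertices are
    distinct. *)
Lemma full_solution_red (lam : labeling P) j :
  partial_solution lam -> (forall v, ~ hole lam v) ->
  exists s : seq (vertex D), [/\ uniq s, k ^ j <= size s &
    forall u, u \in s -> lam u = red /\ size u = j].
Proof.
move=> ps nh; have acc v := (acceptedP lam v).1 (ps v (fun u _ => nh u)).
elim: j => [|j [s [us ss hs]]].
  exists [:: root D]; split=> // u; rewrite inE => /eqP ->.
  by split=> //; apply: (acc _).1.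
exists [seq i :: u | u <- s, i <- enum [pred i : 'I_D | lam (i :: u) == red]].
split.
- apply: allpairs_uniq_dep => // [u _|[u i] [u' i'] _ _ /= [-> ->] //].
  exact: enum_uniq.
- rewrite size_allpairs_dep expnS mulnC.
  apply: leq_trans (_ : size s * k <= _); first by rewrite leq_mul2r ss orbT.
  have {us ss} : forall u, u \in s -> lam u = red by move=> u /hs[].
  elim: s {hs} => //= u s IH hs; rewrite mulSn leq_add //.
    by rewrite -cardE; apply: (acc _).2; apply: hs; rewrite inE eqxx.
  by apply: IH => w ws; apply: hs; rewrite inE ws orbT.
- move=> _ /allpairsPdep[u [i [us' iu ->]]] /=; rewrite (hs _ us').2.
  by move: iu; rewrite mem_enum => /eqP.
Qed.

Lemma mending_volume_ge d : k ^ d <= mending_volume P d.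
Proof.
pose lam : labeling P := fun v => if v is [::] then None else white.
have plam : partial_solution lam.
  move=> v nb; have nhv := nb v (or_introl erefl).
  by case: v nb nhv => [|i w] _ nh; [case: nh|apply/acceptedP].
have [_ /(_ lam (root _) plam erefl)] := mending_volumeP P d.
apply: leq_trans.
have [[lam' [ps nhr nh] ->] _] := mending_costP lam (root _) d.
(* All red vertices of [lam'] are changed, since [lam] is nowhere red. *)
have nh' v : ~ hole lam' v by case: v => // i w; exact: nh.
have [s [us ss hs]] := full_solution_red lam' d ps nh'.
apply: leq_trans ss _; apply: uniq_leq_card_changed => // u /hs[ru <-].
by split; [rewrite ru; case: u {ru} | exact: dist_root_le].
Qed.

(** * Upper bound: mending along a k-ary tree *)

(* [fan u] says that u lies in the tree grown from r along the directions of K. *)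
Section Fan.
Variables (lam : labeling P) (r : vertex D) (K : seq 'I_D).

Fixpoint fan (u : vertex D) : bool :=
  (u == r) || (if u is i :: w then (i \in K) && fan w else false).

(* A filled hole may expose its red children to the acceptance condition: the
   children of the fan are whitened for this reason. *)
Definition fan_mend : labeling P := fun u =>
  if fan u then red else
  if (if u is _ :: w then fan w else false) && (lam u == red) then white
  else lam u.

Lemma fanP u : fan u -> exists2 s, all (mem K) s & u = s ++ r.
Proof.
elim: u => [|i w IH] /= /orP[/eqP <-|//]; try by exists [::].
by case/andP => iK /IH[s sK ->]; exists (i :: s); rewrite //= iK.
Qed.

Lemma fan_mend_hole u : hole fan_mend u -> hole lam u.
Proof. by rewrite /hole /fan_mend; case: ifP => // _; case: ifP. Qed.

(** The head of [s] is the step farthest from [r]; it is unrestricted because whitening can reach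
    any child of the fan. *)
Lemma fan_mend_changed u : lam u <> fan_mend u ->
  exists s, all (mem K) (behead s) /\ u = s ++ r.
Proof.
rewrite /fan_mend; case: ifPn => [/fanP[s sK ->] _|_].
  by exists s; split=> //; case: s sK => //= i s /andP[].
case: u => [|i w] //=; case: ifP => // /andP[/fanP[s sK ->] _] _.
by exists (i :: s).
Qed.

(** Fan vertices get [k] red children from [K]; children leaving the fan are not red and demand
    nothing. Other vertices keep their label, and the last hypothesis prevents filling [r] from
    newly exposing its parent. *)
Lemma fan_mend_partial_solution : uniq K -> size K = k ->
  partial_solution lam ->
  (forall i w, r = i :: w -> ~ hole lam w -> ~ hole lam r) ->
  partial_solution fan_mend.
Proof.
move=> uK sK plam hr x nb; apply/acceptedP.
have [fx|nfx] := boolP (fan x).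
  split=> _; first by rewrite /fan_mend fx.
  rewrite -sK -(card_uniqP uK); apply: subset_leq_card.
  by apply/fintype.subsetP => i iK; rewrite inE /fan_mend /= iK fx orbT.
have keep u : ~~ fan u -> ~ hole fan_mend u -> ~ hole lam u.
  rewrite /hole /fan_mend => /negbTE ->; case: ifP => // /andP[_ /eqP -> //].
have [fp|nfp] := boolP (if x is _ :: w then fan w else false).
  case: x nb nfx fp => // i w nb nfx fp; split=> //.
  by rewrite /fan_mend (negbTE nfx) fp /=; case: ifP => // /eqP.
have mx : fan_mend x = lam x by rewrite /fan_mend (negbTE nfx) (negbTE nfp).
have nhx : ~ hole lam x by rewrite /hole -mx; apply: nb; left.
have /acceptedP[rt cnt] : accepted lam x.
  apply: plam => u [-> //|/orP[]/existsP[i /eqP ui]].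
    apply: keep; first by move: nfp; rewrite ui.
    by apply: nb; right; rewrite ui adj_sym adj_child.
  have [fu|nfu] := boolP (fan u); last first.
    by apply: keep => //; apply: nb; right; rewrite ui adj_child.
  (* A fan vertex whose parent is outside the fan can only be [r]. *)
  move: fu; rewrite ui /= (negbTE nfx) andbF orbF => /eqP ur.
  by rewrite /child ur; apply: hr nhx; rewrite -ur.
(* No child of [x] is whitened, as [x] is not in the fan. *)
rewrite mx; split=> // /cnt h; apply: leq_trans h _; apply: subset_leq_card.
apply/fintype.subsetP => i; rewrite !inE => /eqP li.
by rewrite /fan_mend; case: ifP => // _; rewrite (negbTE nfx) /= li.
Qed.

End Fan.

Lemma mending_cost_le (lam : labeling P) v d : 0 < p ->
  partial_solution lam -> hole lam v ->
  mending_cost lam v d <= D * k ^ d.+1.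
Proof.
move=> p0 plam hv.
have D0 : 0 < D by rewrite expn_gt0.
have kD : 0 < k <= D by rewrite expn_gt0 leq_exp2l ?(ltnW hpq).
have [r [K [uK sK fv szr hr]]] : exists r K, [/\ uniq K, size K = k, fan r K v,
    size v <= (size r).+1 &
    forall i w, r = i :: w -> ~ hole lam w -> ~ hole lam r].
  case: v hv => [|i0 w] hv.
    have [K [uK sK _]] := uniq_seq_through D k (Ordinal D0) kD.
    by exists (root D), K; split.
  have [K [uK sK iK]] := uniq_seq_through D k i0 kD.
  have [hw|nhw] := pselect (hole lam w).
    by exists (i0 :: w), K; split; rewrite //= ?eqxx // => i w' [_ <-].
  have fw : fan w K w by case: (w) => [|? ?] /=; rewrite ?eqxx.
  by exists w, K; split; rewrite //= iK fw orbT.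
have mv : mend lam v (fan_mend lam r K).
  split; first exact: fan_mend_partial_solution.
    by rewrite /hole /fan_mend fv.
  by move=> u nu /fan_mend_hole.
have [_ /(_ _ mv) h] := mending_costP lam v d; apply: leq_trans h _.
(* Positions relative to [r]: the empty word, or any last step after a word over [K]. *)
pose W := [:: [::] & [seq i :: s | i <- enum 'I_D, s <- words _ K d]].
have : size W <= D * k ^ d.+1.
  rewrite /= size_allpairs size_enum_ord.
  apply: leq_trans (_ : D * (size (words _ K d)).+1 <= _).
    by rewrite mulnS -add1n leq_add.
  by rewrite leq_mul2l -sK size_words ?orbT // sK -(expn0 2) ltn_exp2l.
apply: leq_trans.
rewrite -(size_map (fun s => s ++ r) W); apply: card_changed_leq => u.
move=> [/fan_mend_changed[s [sK' ->]] du].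
(* [v] may lie one level below [r], which costs one extra level. *)
have sd : size s <= d.+1.
  have := leq_trans (size_le_dist _ _) (leq_add szr du).
  by rewrite size_cat addSn -addnS addnC leq_add2l.
apply/mapP; exists s => //; case: s sK' sd {du} => [|i s] //= sK' sd; rewrite inE.
by apply/allpairsP; exists (i, s); rewrite mem_enum mem_words.
Qed.

Lemma mending_volume_le d : 0 < p -> mending_volume P d <= D * k ^ d.+1.
Proof.
move=> p0; have [[lam [v [pl hv ->]]] _] := mending_volumeP P d.
exact: mending_cost_le.
Qed.

End RedWhite.

(** * Powers of n and the asymptotic statement *)

Local Open Scope classical_set_scope.
Local Open Scope ring_scope.

(** Raise [D^d <= n < D^(d+1)], with [D = 2^q], to the power [p/q], which turns [D] into [2^p]. *)
Lemma powR_trunc_log_bounds (R : realType) (p q n : nat) :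
  (0 < q)%N -> (0 < n)%N ->
  let d := trunc_log (2 ^ q) n in
  ((2 ^ p) ^ d)%:R <= (n%:R : R) `^ (p%:R / q%:R) <= ((2 ^ p) ^ d.+1)%:R.
Proof.
move=> q0 n0; set d := trunc_log _ _ => /=.
have powE e : (((2 ^ q) ^ e)%:R : R) `^ (p%:R / q%:R) = ((2 ^ p) ^ e)%:R.
  rewrite -!expnM !natrX -!powR_mulrn // -powRrM; congr (_ `^ _).
  by rewrite !natrM; field; rewrite pnatr_eq0 -lt0n.
have q1 : (1 < 2 ^ q)%N by rewrite -(expn0 2) ltn_exp2l.
have pq0 : 0 <= (p%:R / q%:R : R) by rewrite divr_ge0.
rewrite -!powE; apply/andP; split;
    apply: ge0_ler_powR => //; rewrite ?nnegrE ?ler0n // ler_nat.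
  exact: trunc_logP.
exact/ltnW/trunc_log_ltn.
Qed.

Theorem mainTheorem2 (R : realType) (p q : nat) (hp : (1 < p)%N)
    (hpq : (p < q)%N) :
  (fun n : nat =>
     (mending_volume (red_white hpq) (trunc_log (2 ^ q) n))%:R : R^o)
  \is 'Theta_\oo (fun n : nat => (n%:R : R) `^ (p%:R / q%:R) : R^o).
Proof.
have p0 := ltnW hp; have q0 := ltn_trans p0 hpq.
apply/asboolP.
(* With [k = 2^p], the first constant absorbs the gap between [k^d] and [k^(d+1)]; the second comes
   from the bound [D * k^(d+1)]. *)
exists (((2 ^ p)%:R)^-1, (2 ^ q * 2 ^ p)%:R).
  by rewrite /= invr_gt0 !ltr0n ?muln_gt0 !expn_gt0.
near=> n.
have n0 : (0 < n)%N by near: n; exists 1%N.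
have /andP[lo hi] := powR_trunc_log_bounds R p q n q0 n0.
have V1 := mending_volume_ge p q hpq (trunc_log (2 ^ q) n).
have V2 := mending_volume_le p q hpq (trunc_log (2 ^ q) n) p0.
rewrite /= !ger0_norm ?powR_ge0 // ?ler0n //; split.
  rewrite ler_pdivrMl ?ltr0n ?expn_gt0 //; apply: le_trans hi _.
  by rewrite -natrM ler_nat expnS leq_mul2l V1 orbT.
apply: le_trans
  (_ : (2 ^ q * 2 ^ p)%:R * ((2 ^ p) ^ trunc_log (2 ^ q) n)%:R <= _).
  by rewrite -natrM ler_nat -mulnA -expnS.
by rewrite ler_wpM2l.
Unshelve. all: by end_near. Qed.
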